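(* Let $m,n$ be positive integers such that $d=m-n$ is positive and even. Then $2\mid S(m,n)$ if and only if there exists $k\in\mathbb{N}$ such that the $k$-th binary digits of $\left\lfloor\frac{n-1}{4}\right\rfloor$ and of $\frac{d}{2}$ are both equal to $1$.
   Context: $S(m,n)$ denotes the Stirling number of the second kind. $\mathbb{N}$ includes $0$. The $k$-th binary digit of a nonnegative integer $N$ is the coefficient $b_k\in\{0,1\}$ in the binary expansion $N=\sum_{k\ge 0}b_k2^k$ (so it is $0$ for all $k$ beyond the most significant digit). *)

(* Defs.v *)
From mathcomp Require Import all_boot.

Set Implicit Arguments.
Unset Strict Implicit.
Unset Printing Implicit Defensive.

(* S(m, n): the number of partitions of an m-element set into n blocks;
   [partition] requires the blocks to be nonempty. *)
Definition stirling2 (m n : nat) : nat :=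
  #|[set P : {set {set 'I_m}} | partition P [set: 'I_m] & #|P| == n]|.

Definition bin_digit (N k : nat) : nat := (N %/ 2 ^ k) %% 2.

Lemma bin_digit_lt2 (N k : nat) : bin_digit N k < 2.
Proof. by rewrite ltn_mod. Qed.

Lemma bin_digit_expansion (N K : nat) :
  N < 2 ^ K -> N = \sum_(k < K) bin_digit N k * 2 ^ k.
Proof.
elim: K N => [|K IHK] N; first by rewrite big_ord0 expn0 ltnS leqn0 => /eqP.
rewrite expnS mulnC -ltn_divLR // => /IHK IH.
rewrite big_ord_recl /bin_digit expn0 muln1 divn1 {1}(divn_eq N 2) addnC.
congr (_ + _); rewrite {1}IH big_distrl /=; apply: eq_bigr => k _.
by rewrite /bin_digit -divnMA -expnS -mulnA -expnSr.
Qed.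

Lemma bin_digit_eq0 (N k : nat) : N < 2 ^ k -> bin_digit N k = 0.
Proof. by move=> ltN; rewrite /bin_digit divn_small. Qed.

(* Main.v *)
Require Import Defs.
From mathcomp Require Import all_boot.

(** Set partitions are counted by the recurrence
      S(m+1, n+1) = S(m, n) + (n+1) S(m, n+1)
    ([card_partsS], [stirling2E]): a new element either forms a block of its
    own or joins one of the existing blocks.  Modulo 2 the coefficient n+1
    only retains its parity.  Along d = m - n, passing from n+1 to n+2 leaves
    the parities of the S(n+1+d, n+1) unchanged when n is even, and turns them
    into their partial sums over d when n is odd.  Partial summation is
    Pascal's rule along a diagonal, so S(n+1+d, n+1) has the parity of the
    binomial coefficient 'C(n./2 + d, d) ([odd_stirling]); in generating
    function terms, the product of the 1/(1 - j x) for j <= n+1 reduces to a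
    power of 1/(1 - x).

    Lucas' theorem for the prime 2 ([odd_bin_half]) strips one binary digit
    from each argument of a binomial coefficient.  For even d it replaces
    'C(n./2 + d, d), up to parity, by 'C(n %/ 4 + d./2, d./2), and applied repeatedly it gives
    Kummer's criterion: 'C(a + b, b) is even exactly when the addition of a
    and b produces a carry in base 2, that is, when a and b have a digit 1 in
    common ([even_bin_common_digit]). *)

Set Implicit Arguments.
Unset Strict Implicit.
Unset Printing Implicit Defensive.

(** * The recurrence for set partitions *)

Section PartitionRecurrence.

Variable T : finType.
Implicit Types (D B C : {set T}) (P Q : {set {set T}}) (x : T).

(** The first component is a partition, the second the block that [x] joins,
    where the value [set0] stands for the creation of the new block [[set x]]:
    this makes both cases of the recurrence uniform. *)
Definition insert_block x (u : {set {set T}} * {set T}) : {set {set T}} :=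
  (x |: u.2) |: (u.1 :\ u.2).

Definition remove_point x P : {set {set T}} * {set T} :=
  let B := pblock P x :\ x in ((B |: (P :\ pblock P x)) :\ set0, B).

Definition parts D n := [set P | partition P D & #|P| == n].

(** Only the block [B] that receives the new point changes; the other blocks
    of [Q] always partition the complement of [B]. *)
Lemma partition_del_block D Q B : partition Q D -> B \in set0 |: Q ->
  partition (Q :\ B) (D :\: B) /\ B \subset D.
Proof.
move=> partQ /setU1P[-> | QB]; last first.
  by rewrite (partitionD1 partQ QB) (partitionS partQ QB).
rewrite setD0 sub0set (_ : Q :\ set0 = Q) //; apply/setP=> C.
by rewrite !inE; case: eqP => // ->; rewrite (partition0 partQ).
Qed.

Lemma insert_block_partition x D u : x \notin D ->
  partition u.1 D -> u.2 \in set0 |: u.1 ->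
  partition (insert_block x u) (x |: D).
Proof.
case: u => Q B /= notDx partQ QB; have [partQB sBD] := partition_del_block partQ QB.
rewrite (_ : x |: D = (x |: B) :|: (D :\: B)); last first.
  by rewrite -setUA -{1}(setID D B) (setIidPr sBD).
apply: partitionU1 => //; first by apply/set0Pn; exists x; rewrite setU11.
rewrite disjoint_sym disjoints_subset; apply/subsetP=> y.
by rewrite !inE => /andP[/negPf-> Dy]; rewrite orbF; apply: contraNneq notDx => <-.
Qed.

Lemma pblock_insert_block x D u : x \notin D ->
  partition u.1 D -> u.2 \in set0 |: u.1 ->
  pblock (insert_block x u) x = x |: u.2.
Proof.
move=> notDx partQ QB; apply: def_pblock; rewrite ?setU11 //.
exact: partition_trivIset (insert_block_partition notDx partQ QB).
Qed.

Lemma notin_block x D Q C : x \notin D -> partition Q D -> C \in Q -> x \notin C.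
Proof.
by move=> notDx partQ QC; apply: contra notDx => /(subsetP (partitionS partQ QC)).
Qed.

Lemma insert_blockK x D u : x \notin D ->
  partition u.1 D -> u.2 \in set0 |: u.1 ->
  remove_point x (insert_block x u) = u.
Proof.
move=> notDx partQ QB; rewrite /remove_point (pblock_insert_block notDx) //.
case: u partQ QB => Q B /= partQ QB; have [_ sBD] := partition_del_block partQ QB.
have notBx: x \notin B by apply: contra notDx => /(subsetP sBD).
rewrite setU1K // /insert_block /= setU1K; last first.
  rewrite !inE negb_and; apply/orP; right; apply/negP => QxB.
  by have := notin_block notDx partQ QxB; rewrite setU11.
congr (_, _); apply/setP=> C; rewrite !inE.
have [-> | nzC] /= := eqVneq C set0; first by rewrite (partition0 partQ).
by have [eCB | //] := eqVneq C B; move: QB; rewrite !inE -eCB (negPf nzC).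
Qed.

Lemma remove_point_partition x D P : x \notin D -> partition P (x |: D) ->
  [/\ partition (remove_point x P).1 D,
      (remove_point x P).2 \in set0 |: (remove_point x P).1
    & insert_block x (remove_point x P) = P].
Proof.
move=> notDx partP; rewrite /remove_point /insert_block /=.
have Px: x \in cover P by rewrite (cover_partition partP) setU11.
set C := pblock P x; have PC: C \in P by rewrite pblock_mem.
have Cx: x \in C by rewrite mem_pblock.
have partR := partitionD1 partP PC; set R := P :\ C in partR *.
have [sCE def_C] := (partitionS partP PC, setD1K Cx).
set B := C :\ x in def_C *.
have sBD: B \subset D.
  by apply/subsetP=> y; rewrite !inE => /andP[/negPf ny /(subsetP sCE)];
    rewrite !inE ny.
have def_D: (x |: D) :\: C = D :\: B.
  apply/setP=> y; rewrite !inE; case: eqP => //= ->.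
  by rewrite Cx (negPf notDx).
rewrite def_D in partR.
have R0: R :\ set0 = R.
  by apply/setP=> A; rewrite !inE; case: eqP => // ->; rewrite (partition0 partP) andbF.
have notRB: B != set0 -> B \notin R.
  case/set0Pn=> y By; apply/negP=> /(partitionS partR)/subsetP/(_ y By).
  by rewrite inE By.
have [B0 | nzB] := eqVneq B set0.
  move: def_C partR; rewrite B0 !setU0 setD0 => def_C partR.
  rewrite (_ : (set0 |: R) :\ set0 = R); last by rewrite setU1K // (partition0 partR).
  by rewrite setU11 R0 def_C setD1K.
have BR0: (B |: R) :\ set0 = B |: R.
  apply/setP=> A; rewrite !inE; case: (eqVneq A set0) => //= ->.
  by rewrite eq_sym (negPf nzB) (partition0 partP) andbF.
rewrite BR0 !inE eqxx orbT setU1K ?notRB // def_C setD1K //; split=> //.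
have <-: B :|: (D :\: B) = D by rewrite -{2}(setID D B) (setIidPr sBD).
apply: partitionU1 => //.
by rewrite disjoint_sym disjoints_subset; apply/subsetP=> y; rewrite !inE => /andP[].
Qed.

Lemma card_insert_block x D u : x \notin D ->
  partition u.1 D -> u.2 \in set0 |: u.1 ->
  #|insert_block x u| = (u.2 == set0) + #|u.1|.
Proof.
case: u => Q B /= notDx partQ QB; rewrite /insert_block cardsU1 /=.
have -> : x |: B \notin Q :\ B.
  rewrite !inE negb_and; apply/orP; right; apply/negP => QxB.
  by have := notin_block notDx partQ QxB; rewrite setU11.
rewrite (cardsD1 B Q); move: QB; rewrite !inE.
by have [-> | _ /= ->] := eqVneq; rewrite ?(partition0 partQ).
Qed.

(** Deleting [x] inverts [insert_block], so the partitions of [x |: D] are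
    counted by the pairs (partition [Q] of [D], element of [set0 |: Q]). *)
Lemma card_partsS x D n : x \notin D ->
  #|parts (x |: D) n.+1| = #|parts D n| + n.+1 * #|parts D n.+1|.
Proof.
move=> notDx.
pose X := [set u : {set {set T}} * {set T} |
  [&& partition u.1 D, u.2 \in set0 |: u.1 & (u.2 == set0) + #|u.1| == n.+1]].
have ->: parts (x |: D) n.+1 = insert_block x @: X.
  apply/setP=> P; apply/idP/imsetP=> [|[u]]; rewrite inE.
    case/andP=> /(remove_point_partition notDx)[partQ QB defP] cardP.
    exists (remove_point x P) => //.
    by rewrite inE partQ QB -(card_insert_block notDx partQ QB) defP.
  case/and3P=> partQ QB cardQ ->; rewrite inE.
  by rewrite (insert_block_partition notDx) // (card_insert_block notDx).
rewrite card_in_imset; last first.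
  apply: (can_in_inj (g := remove_point x)) => u.
  by rewrite inE => /and3P[partQ QB _]; apply: (insert_blockK notDx).
(* either [x] is a singleton block, or it joins a block of [u.1] *)
have ->: X = ((fun Q => (Q, set0)) @: parts D n) :|:
             [set u | (u.1 \in parts D n.+1) && (u.2 \in u.1)].
  apply/setP=> [[Q B]]; rewrite !inE /=; apply/idP/idP.
    case/and3P=> partQ /predU1P[-> | QB].
      by rewrite eqxx => cQ; rewrite imset_f // inE partQ.
    by rewrite (negPf (partition_neq0 partQ QB)) partQ QB => ->; rewrite orbT.
  case/orP=> [/imsetP[Q1] | /andP[/andP[partQ cQ] QB]].
    by rewrite inE => /andP[partQ cQ] [-> ->]; rewrite partQ !eqxx.
  by rewrite partQ QB orbT (negPf (partition_neq0 partQ QB)).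
rewrite cardsU card_imset => [|Q1 Q2 [] //].
rewrite (_ : _ :&: _ = set0) ?cards0 ?subn0; last first.
  apply/setP=> u; rewrite !inE; apply/negP=> /andP[/imsetP[Q]].
  rewrite inE => /andP[partQ _] -> /=; rewrite (partition0 partQ).
  by rewrite andbF.
congr (_ + _); rewrite -sum1_card (eq_bigl _ _ (fun u => in_set _ u)).
rewrite -(pair_big_dep (mem (parts D n.+1)) (fun Q B => B \in Q) (fun _ _ => 1)) /=.
rewrite (eq_bigr (fun=> n.+1)) => [|Q]; first by rewrite sum_nat_const mulnC.
by rewrite inE sum1_card => /andP[_ /eqP].
Qed.

Lemma card_parts_set0 n : #|parts set0 n| = (n == 0).
Proof.
have [-> | n_gt0] := eqVneq n 0.
  rewrite (_ : parts _ _ = [set set0]) ?cards1 //; apply/setP=> P.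
  rewrite !inE partition_set0; have [->|//] := eqVneq.
  by rewrite cards0.
apply/eqP; rewrite cards_eq0; apply/eqP/setP=> P; rewrite !inE partition_set0.
by have [->|//] := eqVneq; rewrite cards0 eq_sym (negPf n_gt0).
Qed.

Lemma card_parts0 x D : x \in D -> #|parts D 0| = 0.
Proof.
move=> Dx; apply/eqP; rewrite cards_eq0; apply/eqP/setP=> P; rewrite !inE cards_eq0.
apply/negP=> /andP[partP /eqP P0]; move: Dx.
by rewrite -(cover_partition partP) P0 /cover big_set0 inE.
Qed.

End PartitionRecurrence.

(** [card_partsS] changes the ground set, so it determines these numbers inside
    any one type; this is the common value. *)
Fixpoint stirling (m n : nat) : nat :=
  match m, n with
  | 0, 0 => 1
  | m'.+1, n'.+1 => stirling m' n' + n'.+1 * stirling m' n'.+1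
  | _, _ => 0
  end.

Lemma card_parts (T : finType) (D : {set T}) n : #|parts D n| = stirling #|D| n.
Proof.
move cardD: #|D| => c; elim: c D n cardD => [|c IHc] D n cardD.
  by move/eqP: cardD; rewrite cards_eq0 => /eqP->; rewrite card_parts_set0; case: n.
have /card_gt0P[x Dx]: 0 < #|D| by rewrite cardD.
case: n => [|n] /=; first exact: card_parts0 Dx.
have cardDx: #|D :\ x| = c by move: cardD; rewrite (cardsD1 x) Dx => -[].
by rewrite -{1}(setD1K Dx) card_partsS ?setD11 // !IHc.
Qed.

Lemma stirling2E m n : stirling2 m n = stirling m n.
Proof. by rewrite -[in RHS](card_ord m) -cardsT -card_parts. Qed.

(** * Parity of Stirling numbers *)

Lemma stirling_small m n : m < n -> stirling m n = 0.
Proof.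
elim: m n => [|m IHm] [|n] //= lt_mn.
by rewrite !IHm ?muln0 // ltnW.
Qed.

Lemma stirling_diag n : stirling n n = 1.
Proof. by elim: n => //= n ->; rewrite stirling_small // muln0. Qed.

(** Both sides, as functions of [d], are constant from [n] to [n.+1] for even
    [n] and become their partial sums for odd [n]: on the left because the
    coefficient [n.+2] has the parity of [n], on the right by Pascal's rule. *)
Lemma odd_stirling n d : odd (stirling (n.+1 + d) n.+1) = odd 'C(n./2 + d, d).
Proof.
elim: d n => [|d IHd] n; first by rewrite !addn0 stirling_diag bin0.
elim: n => [|n IHn].
  have ->: stirling (1 + d.+1) 1 = 1 * stirling (1 + d) 1 by [].
  by rewrite mul1n IHd !binn.
rewrite addnS.
have -> : stirling (n.+2 + d).+1 n.+2 =
    stirling (n.+1 + d.+1) n.+1 + n.+2 * stirling (n.+2 + d) n.+2.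
  by rewrite -addSnnS.
rewrite oddD oddM IHn IHd /=.
rewrite uphalf_half negbK.
by case: (odd n); rewrite ?addbF // add1n !addSn addnS [in RHS]binS oddD.
Qed.

(** * Binomial coefficients modulo 2 *)

(** Lucas' theorem at the prime 2, one digit at a time: modulo 2,
    (1 + X)^n is (1 + X^2)^(n./2) times (1 + X)^(odd n).  Pascal's rule gives
    it by comparing the parities of [n] and [k]. *)
Lemma odd_bin_half n k :
  odd 'C(n, k) = odd 'C(n./2, k./2) && (odd k ==> odd n).
Proof.
elim: n k => [|n IHn] [|k]; rewrite ?bin0 //.
  by case: k => [|k] //; rewrite bin0n.
rewrite binS oddD !IHn /= !uphalf_half.
case: (odd n); case: (odd k); rewrite /= ?add1n ?add0n ?andbT ?andbF ?addbF //=.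
- by rewrite binS oddD.
- by rewrite addbb.
Qed.

Lemma bin_digit0 N : bin_digit N 0 = odd N.
Proof. by rewrite /bin_digit expn0 divn1 modn2. Qed.

Lemma bin_digitS N k : bin_digit N k.+1 = bin_digit N./2 k.
Proof. by rewrite /bin_digit expnS divnMA divn2. Qed.

(** If the lowest digits of [a] and [b] are both 1, then [a + b] is even and
    [odd_bin_half] makes the binomial even; otherwise no carry occurs and it
    passes to the halves of [a] and [b]. *)
Lemma even_bin_common_digit a b :
  ~~ odd 'C(a + b, b) <-> exists k, bin_digit a k = 1 /\ bin_digit b k = 1.
Proof.
elim/ltn_ind: a b => -[_ | a IHa] b.
  rewrite binn; split=> // -[k []].
  by rewrite /bin_digit div0n.
have ltaa: a.+1./2 < a.+1 by rewrite ltn_half_double -addnn -[X in X < _]addn0 ltn_add2l.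
have [/andP[odd_a odd_b] | not_ab] := boolP (odd a.+1 && odd b).
  split=> [_ | _]; first by exists 0; rewrite !bin_digit0 odd_a odd_b.
  by rewrite odd_bin_half oddD odd_a odd_b andbF.
rewrite odd_bin_half halfD (negPf not_ab) add0n oddD.
have -> : odd b ==> odd a.+1 (+) odd b.
  by move: not_ab; case: (odd b); rewrite ?andbT //= => /negPf->.
rewrite andbT; apply: iff_trans (IHa _ ltaa _) _; split=> -[k].
  by exists k.+1; rewrite !bin_digitS.
case: k => [|k]; last by rewrite !bin_digitS; exists k.
by rewrite !bin_digit0; case: (odd a.+1) not_ab; case: (odd b) => // _ [].
Qed.

Theorem proposition11 (m n d : nat) (m_gt0 : 0 < m) (n_gt0 : 0 < n)
    (def_d : d = m - n) (d_gt0 : 0 < d) (d_even : ~~ odd d) :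
  2 %| stirling2 m n <->
  exists k : nat, bin_digit ((n - 1) %/ 4) k = 1 /\ bin_digit (d %/ 2) k = 1.
Proof.
have ->: m = n + d by rewrite def_d subnKC // ltnW // -subn_gt0 -def_d.
case: n n_gt0 {def_d} => // n _.
apply: iff_trans _ (even_bin_common_digit _ _); rewrite dvdn2 stirling2E odd_stirling.
by rewrite odd_bin_half halfD (negPf d_even) andbF andbT subn1 !divn2 (divnMA n 2 2) !divn2.
Qed.
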